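(* Let $(\mathfrak g,[\cdot,\cdot,\cdot],\alpha,\beta)$ be a 3-Bihom-Lie superalgebra over a field $\mathbb K$ with $\alpha,\beta$ bijective, such that the coadjoint map $\mathrm{ad}^*$ defines a representation $(\mathfrak g^*,\mathrm{ad}^*,\widetilde\alpha,\widetilde\beta)$ of $\mathfrak g$, and let $\theta:\mathfrak g\times\mathfrak g\times\mathfrak g\to\mathfrak g^*$ be a 3-cocycle associated with $\mathrm{ad}^*$. Let $(\mathfrak g\oplus\mathfrak g^*,[\cdot,\cdot,\cdot]_\theta,\alpha+\widetilde\alpha,\beta+\widetilde\beta)$ be the corresponding $T_\theta$-extension of $\mathfrak g$ by $\mathfrak g^*$. (1) If $\mathfrak g$ is solvable, then $(\mathfrak g\oplus\mathfrak g^*,[\cdot,\cdot,\cdot]_\theta,\alpha+\widetilde\alpha,\beta+\widetilde\beta)$ is solvable. (2) If $\mathfrak g$ is nilpotent, then $(\mathfrak g\oplus\mathfrak g^*,[\cdot,\cdot,\cdot]_\theta,\alpha+\widetilde\alpha,\beta+\widetilde\beta)$ is nilpotent.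
   Context: For a homogeneous element $x$, $|x|\in\mathbb Z_2$ denotes its degree; identities involving $|x|$ are for homogeneous elements (extended multilinearly). A 3-Bihom-Lie superalgebra over $\mathbb K$ is a quadruple $(\mathfrak g,[\cdot,\cdot,\cdot],\alpha,\beta)$ consisting of a $\mathbb Z_2$-graded vector space $\mathfrak g=\mathfrak g_0\oplus\mathfrak g_1$, an even trilinear map $[\cdot,\cdot,\cdot]:\mathfrak g\times\mathfrak g\times\mathfrak g\to\mathfrak g$ and two even linear maps $\alpha,\beta:\mathfrak g\to\mathfrak g$ such that for all $x,y,z,u,v\in\mathfrak g$: (a) $\alpha\circ\beta=\beta\circ\alpha$; (b) $\alpha([x,y,z])=[\alpha(x),\alpha(y),\alpha(z)]$ and $\beta([x,y,z])=[\beta(x),\beta(y),\beta(z)]$; (c) $[\beta(x),\beta(y),\alpha(z)]=-(-1)^{|x||y|}[\beta(y),\beta(x),\alpha(z)]=-(-1)^{|y||z|}[\beta(x),\beta(z),\alpha(y)]$; (d) $[\beta^2(x),\beta^2(y),[\beta(z),\beta(u),\alpha(v)]]=(-1)^{(|u|+|v|)(|x|+|y|+|z|)}[\beta^2(u),\beta^2(v),[\beta(x),\beta(y),\alpha(z)]]-(-1)^{(|z|+|v|)(|x|+|y|)+|u||v|}[\beta^2(z),\beta^2(v),[\beta(x),\beta(y),\alpha(u)]]+(-1)^{(|z|+|u|)(|x|+|y|)}[\beta^2(z),\beta^2(u),[\beta(x),\beta(y),\alpha(v)]]$. Solvable/nilpotent: define $\mathfrak g^{(0)}=\mathfrak g$,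 $\mathfrak g^{(n+1)}=[\mathfrak g^{(n)},\mathfrak g^{(n)},\mathfrak g]$ and $\mathfrak g^0=\mathfrak g$, $\mathfrak g^{n+1}=[\mathfrak g^n,\mathfrak g,\mathfrak g]$ (linear spans of brackets). $\mathfrak g$ is solvable if $\mathfrak g^{(k)}=0$ for some integer $k$, and nilpotent if $\mathfrak g^k=0$ for some integer $k$. A representation of $\mathfrak g$ is a 4-tuple $(M,\rho,\alpha_M,\beta_M)$ where $M$ is a vector superspace, $\alpha_M,\beta_M\in\mathrm{End}(M)$ are two commuting even linear maps and $\rho:\mathfrak g\times\mathfrak g\to\mathrm{End}(M)$ is an even super-skewsymmetric bilinear map ($\rho(u,v)=-(-1)^{|u||v|}\rho(v,u)$) such that for all $u,v,x,y\in\mathfrak g$: (R1) $\rho(\alpha(u),\alpha(v))\circ\alpha_M=\alpha_M\circ\rho(u,v)$; (R2) $\rho(\beta(u),\beta(v))\circ\beta_M=\beta_M\circ\rho(u,v)$; (R3) $\rho(\alpha\beta(u),\alpha\beta(v))\circ\rho(x,y)=(-1)^{(|u|+|v|)(|x|+|y|)}\rho(\beta(x),\beta(y))\circ\rho(\alpha(u),\alpha(v))+\rho([\beta(u),\beta(v),x],\beta(y))\circ\beta_M+(-1)^{|x|(|u|+|v|)}\rho(\beta(x),[\beta(u),\beta(v),y])\circ\beta_M$; (R4) $\rho([\beta(u),\beta(v),x],\beta(y))\circ\beta_M=(-1)^{|u|(|x|+|v|)}\rho(\alpha\beta(v),\beta(x))\circ\rho(\alpha(u),y)+(-1)^{|x|(|u|+|v|)}\rho(\beta(x),\alpha\beta(u))\circ\rho(\alpha(v),y)+\rho(\alpha\beta(u),\alpha\beta(v))\circ\rho(x,y)$.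 Coadjoint map: $\mathfrak g^*$ is the dual space with its usual grading, $\widetilde\alpha(f)=f\circ\alpha$, $\widetilde\beta(f)=f\circ\beta$, $\mathrm{ad}(x,y)(z)=[x,y,z]$, $\mathrm{ad}^*(x,y)(f)=-(-1)^{|f|(|x|+|y|)}f\circ\mathrm{ad}(x,y)$. A 3-cocycle associated with a representation $(M,\rho,\alpha_M,\beta_M)$ is an even trilinear map $\theta:\mathfrak g\times\mathfrak g\times\mathfrak g\to M$ such that for all $x_1,\dots,x_5\in\mathfrak g$: (C1) $\alpha_M\theta(x_1,x_2,x_3)=\theta(\alpha(x_1),\alpha(x_2),\alpha(x_3))$; (C2) $\beta_M\theta(x_1,x_2,x_3)=\theta(\beta(x_1),\beta(x_2),\beta(x_3))$; (C3) $\theta(\beta(x_1),\beta(x_2),\alpha(x_3))=-(-1)^{|x_1||x_2|}\theta(\beta(x_2),\beta(x_1),\alpha(x_3))=-(-1)^{|x_2||x_3|}\theta(\beta(x_1),\beta(x_3),\alpha(x_2))$; (C4) writing $\Theta(a,b;c,d,e)=\theta(\beta^2(a),\beta^2(b),[\beta(c),\beta(d),\alpha(e)])+\rho(\beta^2(a),\beta^2(b))\theta(\beta(c),\beta(d),\alpha(e))$, $\Theta(x_1,x_2;x_3,x_4,x_5)=(-1)^{(|x_4|+|x_5|)(|x_1|+|x_2|+|x_3|)}\Theta(x_4,x_5;x_1,x_2,x_3)-(-1)^{(|x_3|+|x_5|)(|x_1|+|x_2|)+|x_4||x_5|}\Theta(x_3,x_5;x_1,x_2,x_4)+(-1)^{(|x_3|+|x_4|)(|x_1|+|x_2|)}\Theta(x_3,x_4;x_1,x_2,x_5)$.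 The $T_\theta$-extension of $\mathfrak g$ by $\mathfrak g^*$ is the 3-Bihom-Lie superalgebra on $\mathfrak g\oplus\mathfrak g^*$ (graded by $\mathfrak g_i\oplus(\mathfrak g^* )_i$) with $(\alpha+\widetilde\alpha)(x+f)=\alpha(x)+\widetilde\alpha(f)$, $(\beta+\widetilde\beta)(x+f)=\beta(x)+\widetilde\beta(f)$ and, for homogeneous $x+f,y+g,z+h$, $[x+f,y+g,z+h]_\theta=[x,y,z]+\theta(x,y,z)+\mathrm{ad}^*(x,y)(h)-(-1)^{|y||z|}\mathrm{ad}^*(x,\alpha^{-1}\beta(z))(\widetilde\alpha\widetilde\beta^{-1}(g))+(-1)^{|x|(|y|+|z|)}\mathrm{ad}^*(y,\alpha^{-1}\beta(z))(\widetilde\alpha\widetilde\beta^{-1}(f))$. *)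

(* Defs.v *)
From HB Require Import structures.
From mathcomp Require Import all_boot all_order all_algebra.
From mathcomp Require Import all_classical.
Set Implicit Arguments.
Unset Strict Implicit.
Unset Printing Implicit Defensive.
Import GRing.Theory.
Local Open Scope classical_set_scope.
Local Open Scope ring_scope.

(* The decomposition V = V_0 (+) V_1 is given by its two projections;
   V_i is the set of fixed points of hcomp i (see homog). *)
HB.mixin Record isSuperspace (K : fieldType) V of GRing.Lmodule K V := {
  hcomp : 'Z_2 -> {linear V -> V};
  hcomp_hcomp : forall i j x,
    hcomp i (hcomp j x) = if i == j then hcomp j x else 0;
  hcomp_sum : forall x, \sum_i hcomp i x = x }.

#[short(type="superType")]
HB.structure Definition Superspace (K : fieldType) :=
  {V of isSuperspace K V & GRing.Lmodule K V}.

Definition homog (K : fieldType) (V : superType K) (i : 'Z_2) (x : V) : Prop :=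
  hcomp i x = x.

Lemma hcomp_homog (K : fieldType) (V : superType K) (i j : 'Z_2) (x : V) :
  homog j x -> hcomp i x = if i == j then x else 0.
Proof. by move=> xj; rewrite -{1}xj hcomp_hcomp xj. Qed.

Definition sgn (K : fieldType) (i : 'Z_2) : K := (-1) ^+ i.
Arguments sgn {K} i.

Definition even_map (K : fieldType) (V W : superType K) (f : V -> W) : Prop :=
  forall i x, homog i x -> homog i (f x).

Definition even3 (K : fieldType) (U V W X : superType K)
    (f : U -> V -> W -> X) : Prop :=
  forall i j k x y z, homog i x -> homog j y -> homog k z ->
    homog (i + j + k) (f x y z).

Section Trilinear.
Variables (K : fieldType) (U V W X : lmodType K).

Definition trilinear (f : U -> V -> W -> X) : Prop :=
  [/\ forall y z, linear (fun x => f x y z),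
      forall x z, linear (fun y => f x y z) &
      forall x y, linear (f x y)].

Record trilin := Trilin {
  tri_fun :> U -> V -> W -> X;
  tri_funP : trilinear tri_fun }.

(* f x y, for a trilinear f; this is ad(x,y) if f is a bracket. *)
Definition tri_ad (f : trilin) (x : U) (y : V) : W -> X := f x y.

Lemma tri_ad_linear f x y : linear (tri_ad f x y).
Proof. by case: (tri_funP f). Qed.
HB.instance Definition _ f x y :=
  GRing.isLinear.Build K W X _ (tri_ad f x y) (@tri_ad_linear f x y).

End Trilinear.

Section TrilinearTheory.
Variables (K : fieldType) (U V W X : lmodType K).
Implicit Types f g : U -> V -> W -> X.

Lemma trilinearD f g : trilinear f -> trilinear g ->
  trilinear (fun x y z => f x y z + g x y z).
Proof.
move=> [f1 f2 f3] [g1 g2 g3]; split=> [y z|x z|x y] a u v /=.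
- by rewrite f1 g1 scalerDr addrACA.
- by rewrite f2 g2 scalerDr addrACA.
- by rewrite f3 g3 scalerDr addrACA.
Qed.

Lemma trilinearZ c f : trilinear f -> trilinear (fun x y z => c *: f x y z).
Proof.
move=> [f1 f2 f3]; split=> [y z|x z|x y] a u v /=.
- by rewrite f1 scalerDr !scalerA mulrC.
- by rewrite f2 scalerDr !scalerA mulrC.
- by rewrite f3 scalerDr !scalerA mulrC.
Qed.

Lemma trilinear_comp (U' V' W' : lmodType K) (a : U' -> U) (b : V' -> V)
    (c : W' -> W) f :
  linear a -> linear b -> linear c -> trilinear f ->
  trilinear (fun x y z => f (a x) (b y) (c z)).
Proof.
move=> aL bL cL [f1 f2 f3]; split=> [y z|x z|x y] k u v /=.
- by rewrite aL f1.
- by rewrite bL f2.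
- by rewrite cL f3.
Qed.

Lemma trilinear_swap f : trilinear f -> trilinear (fun x z y => f x y z).
Proof. by move=> [f1 f2 f3]; split=> *; [exact: f1|exact: f3|exact: f2]. Qed.

Lemma trilinear_rot f : trilinear f -> trilinear (fun z x y => f x y z).
Proof. by move=> [f1 f2 f3]; split=> *; [exact: f3|exact: f1|exact: f2]. Qed.

Lemma trilinear_pair (Y : lmodType K) f (h : U -> V -> W -> Y) :
  trilinear f -> trilinear h -> trilinear (fun x y z => (f x y z, h x y z)).
Proof.
move=> [f1 f2 f3] [h1 h2 h3]; split=> [y z|x z|x y] k u v /=.
- by rewrite f1 h1.
- by rewrite f2 h2.
- by rewrite f3 h3.
Qed.

End TrilinearTheory.

(* A family F i j k of formulas meant for arguments of degrees i, j, k,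
   extended to all arguments by multilinearity. *)
Section HomogeneousExtension.
Variables (K : fieldType) (U V W : superType K) (X : lmodType K).
Variable F : 'Z_2 -> 'Z_2 -> 'Z_2 -> U -> V -> W -> X.

Definition homog_ext (x : U) (y : V) (z : W) : X :=
  \sum_i \sum_j \sum_k F i j k (hcomp i x) (hcomp j y) (hcomp k z).

Lemma homog_ext_trilinear :
  (forall i j k, trilinear (F i j k)) -> trilinear homog_ext.
Proof.
move=> FP; have big3D (a : K) (A B C : 'Z_2 -> 'Z_2 -> 'Z_2 -> X) :
    (forall i j k, A i j k = a *: B i j k + C i j k) ->
    \sum_i \sum_j \sum_k A i j k =
    a *: (\sum_i \sum_j \sum_k B i j k) + \sum_i \sum_j \sum_k C i j k.
  move=> ABC; rewrite scaler_sumr -big_split; apply: eq_bigr => i _ /=.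
  rewrite scaler_sumr -big_split; apply: eq_bigr => j _ /=.
  by rewrite scaler_sumr -big_split; apply: eq_bigr => k _ /=.
split=> [y z|x z|x y] a u v; apply: big3D => i j k;
  rewrite linearP; case: (FP i j k) => F1 F2 F3.
- exact: F1.
- exact: F2.
- exact: F3.
Qed.

Lemma homog_extE i j k x y z : (forall i j k, trilinear (F i j k)) ->
  homog i x -> homog j y -> homog k z -> homog_ext x y z = F i j k x y z.
Proof.
move=> FP xi yj zk.
have F1 a b c u v : F a b c 0 u v = 0.
  by case: (FP a b c) => F1 _ _; have := F1 u v (-1) 0 0;
     rewrite scaleN1r oppr0 addr0 scaleN1r addNr.
have F2 a b c u v : F a b c u 0 v = 0.
  by case: (FP a b c) => _ F2 _; have := F2 u v (-1) 0 0;
     rewrite scaleN1r oppr0 addr0 scaleN1r addNr.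
have F3 a b c u v : F a b c u v 0 = 0.
  by case: (FP a b c) => _ _ F3; have := F3 u v (-1) 0 0;
     rewrite scaleN1r oppr0 addr0 scaleN1r addNr.
rewrite /homog_ext (bigD1 i) //= [X in _ + X]big1 ?addr0; last first.
  move=> a /negPf ai; rewrite big1 // => b _; rewrite big1 // => c _.
  by rewrite (hcomp_homog a xi) ai F1.
rewrite (bigD1 j) //= [X in _ + X]big1 ?addr0; last first.
  move=> b /negPf bj; rewrite big1 // => c _.
  by rewrite (hcomp_homog b yj) bj F2.
rewrite (bigD1 k) //= [X in _ + X]big1 ?addr0; last first.
  by move=> c /negPf ck; rewrite (hcomp_homog c zk) ck F3.
by rewrite xi yj zk.
Qed.

End HomogeneousExtension.

(* The full algebraic dual: nothing here is assumed finite dimensional. *)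
Section Dual.
Variables (K : fieldType).

Definition dual (V : lmodType K) := {linear V -> K^o}.

Section DualLmodule.
Variable V : lmodType K.
Implicit Types f g h : dual V.

HB.instance Definition _ := gen_eqMixin (dual V).
HB.instance Definition _ := gen_choiceMixin (dual V).

Lemma dualP f g : (forall x, f x = g x) -> f = g.
Proof.
case: f g => f [[fD] [fZ]] [g [[gD] [gZ]]] /= fg.
have {}fg : f = g by apply/funext.
rewrite {}fg in fD fZ *; congr (GRing.Linear.Pack (GRing.Linear.Class _ _));
by congr (_ _); exact: Prop_irrelevance.
Qed.

Definition dual0 : dual V := \0.
Definition dual_opp f : dual V := \- f.
Definition dual_add f g : dual V := f \+ g.
Definition dual_scale (a : K) f : dual V := a \*: f.

Lemma dual_addA : associative dual_add.
Proof. by move=> f g h; apply: dualP => x; exact: addrA. Qed.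
Lemma dual_addC : commutative dual_add.
Proof. by move=> f g; apply: dualP => x; exact: addrC. Qed.
Lemma dual_add0 : left_id dual0 dual_add.
Proof. by move=> f; apply: dualP => x; exact: add0r. Qed.
Lemma dual_addN : left_inverse dual0 dual_opp dual_add.
Proof. by move=> f; apply: dualP => x; exact: addNr. Qed.
HB.instance Definition _ :=
  GRing.isZmodule.Build (dual V) dual_addA dual_addC dual_add0 dual_addN.

Lemma dual_scaleA a b f :
  dual_scale a (dual_scale b f) = dual_scale (a * b) f.
Proof. by apply: dualP => x; exact: scalerA. Qed.
Lemma dual_scale1 : left_id 1 dual_scale.
Proof. by move=> f; apply: dualP => x; exact: scale1r. Qed.
Lemma dual_scaleDr : right_distributive dual_scale +%R.
Proof. by move=> a f g; apply: dualP => x; exact: scalerDr. Qed.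
Lemma dual_scaleDl f : {morph dual_scale^~ f : a b / a + b}.
Proof. by move=> a b; apply: dualP => x; exact: scalerDl. Qed.
HB.instance Definition _ := GRing.Zmodule_isLmodule.Build K (dual V)
  dual_scaleA dual_scale1 dual_scaleDr dual_scaleDl.

End DualLmodule.

Section Transpose.
Variables (V W : lmodType K) (a : {linear V -> W}).

Definition transpose (f : dual W) : dual V := (f : W -> K^o) \o a.

Lemma transpose_linear : linear transpose.
Proof. by move=> c f g; exact: dualP. Qed.
HB.instance Definition _ :=
  GRing.isLinear.Build K (dual W) (dual V) _ transpose transpose_linear.

End Transpose.

Section DualSuperspace.
Variable V : superType K.

Definition dual_hcomp (i : 'Z_2) : {linear dual V -> dual V} :=
  transpose (hcomp i).

Lemma dual_hcomp_hcomp i j f :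
  dual_hcomp i (dual_hcomp j f) = if i == j then dual_hcomp j f else 0.
Proof.
apply: dualP => x; rewrite [LHS]/= hcomp_hcomp eq_sym.
by case: eqP => [->|] //; rewrite linear0.
Qed.

Lemma dual_sumE (I : finType) (F : I -> dual V) x :
  (\sum_i F i) x = \sum_i F i x.
Proof. by elim/big_ind2: _ => // f1 r1 f2 r2 <- <-. Qed.

Lemma dual_hcomp_sum f : \sum_i dual_hcomp i f = f.
Proof.
by apply: dualP => x; rewrite dual_sumE -[in RHS](hcomp_sum x) linear_sum.
Qed.

HB.instance Definition _ :=
  isSuperspace.Build K (dual V) dual_hcomp_hcomp dual_hcomp_sum.

Lemma dual_homogP i (f : dual V) :
  homog i f <-> forall x, homog (i + 1) x -> f x = 0.
Proof.
split=> [fi x xi|fi].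
  rewrite -fi /hcomp /= (hcomp_homog i xi).
  suff /negPf -> : i != i + 1 by rewrite linear0.
  by rewrite -subr_eq0 opprD addNKr oppr_eq0.
apply: dualP => x; rewrite /hcomp /= -[in RHS](hcomp_sum x) linear_sum /=.
rewrite (bigD1 i) //= big1 ?addr0 // => j ji; apply: fi.
suff -> : i + 1 = j by rewrite /homog hcomp_hcomp eqxx.
by case: i j ji => [[|[|//]] ?] [[|[|//]] ?] // _; apply/val_inj.
Qed.

End DualSuperspace.

End Dual.

Section DirectSum.
Variables (K : fieldType).

Section SumMap.
Variables (V W V' W' : lmodType K).
Variables (a : {linear V -> V'}) (b : {linear W -> W'}).

Definition dsum_map (u : V * W) : V' * W' := (a u.1, b u.2).

Lemma dsum_map_linear : linear dsum_map.
Proof. by move=> c [x y] [x' y']; rewrite /dsum_map /= !linearP. Qed.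
HB.instance Definition _ :=
  GRing.isLinear.Build K (V * W)%type (V' * W')%type _ dsum_map dsum_map_linear.

End SumMap.

Variables (V W : superType K).

Definition dsum_hcomp (i : 'Z_2) : {linear (V * W)%type -> (V * W)%type} :=
  dsum_map (hcomp i) (hcomp i).

Lemma dsum_hcomp_hcomp i j u :
  dsum_hcomp i (dsum_hcomp j u) = if i == j then dsum_hcomp j u else 0.
Proof. by rewrite /= /dsum_map /= !hcomp_hcomp; case: eqP. Qed.

Lemma dsum_hcomp_sum u : \sum_i dsum_hcomp i u = u.
Proof.
case: u => x y; rewrite -{2}(hcomp_sum x) -{2}(hcomp_sum y).
by elim/big_ind3: _ => // ? ? ? ? ? ? -> ->.
Qed.

HB.instance Definition _ :=
  isSuperspace.Build K (V * W)%type dsum_hcomp_hcomp dsum_hcomp_sum.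

Lemma dsum_homogP i (x : V) (y : W) :
  homog i ((x, y) : (V * W)%type) <-> homog i x /\ homog i y.
Proof. by split=> [[]|[xi yi]] //; congr (_, _). Qed.

End DirectSum.

(* Quadruples (g, [.,.,.], alpha, beta) before any identity is imposed. *)
Record bihom3 (K : fieldType) := Bihom3 {
  carrier :> superType K;
  bracket : trilin carrier carrier carrier carrier;
  alpha : {linear carrier -> carrier};
  beta : {linear carrier -> carrier} }.

Record is_3BihomLie (K : fieldType) (g : bihom3 K) : Prop := {
  bracket_even : even3 (bracket g);
  alpha_even : even_map (alpha g);
  beta_even : even_map (beta g);
  alpha_beta : forall x, alpha g (beta g x) = beta g (alpha g x);
  alpha_bracket : forall x y z,
    alpha g (bracket g x y z) = bracket g (alpha g x) (alpha g y) (alpha g z);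
  beta_bracket : forall x y z,
    beta g (bracket g x y z) = bracket g (beta g x) (beta g y) (beta g z);
  bracket_skew12 : forall (i j k : 'Z_2) (x y z : g),
    homog i x -> homog j y -> homog k z ->
    bracket g (beta g x) (beta g y) (alpha g z) =
    - (sgn (i * j) *: bracket g (beta g y) (beta g x) (alpha g z));
  bracket_skew23 : forall (i j k : 'Z_2) (x y z : g),
    homog i x -> homog j y -> homog k z ->
    bracket g (beta g x) (beta g y) (alpha g z) =
    - (sgn (j * k) *: bracket g (beta g x) (beta g z) (alpha g y));
  bracket_jacobi : forall (dx dy dz du dv : 'Z_2) (x y z u v : g),
    homog dx x -> homog dy y -> homog dz z -> homog du u -> homog dv v ->
    let b2 t := beta g (beta g t) in
    let br p q r := bracket g (beta g p) (beta g q) (alpha g r) in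
    bracket g (b2 x) (b2 y) (br z u v) =
      sgn ((du + dv) * (dx + dy + dz)) *: bracket g (b2 u) (b2 v) (br x y z)
    - sgn ((dz + dv) * (dx + dy) + du * dv) *:
        bracket g (b2 z) (b2 v) (br x y u)
    + sgn ((dz + du) * (dx + dy)) *: bracket g (b2 z) (b2 u) (br x y v) }.

Section Series.
Variables (K : fieldType).

Definition lspan (V : lmodType K) (A : set V) : set V :=
  [set x | exists (n : nat) (c : 'I_n -> K) (v : 'I_n -> V),
     (forall i, A (v i)) /\ x = \sum_(i < n) c i *: v i].

Variable g : bihom3 K.

Definition bracket_span (A B C : set g) : set g :=
  lspan [set v | exists x y z,
    [/\ A x, B y, C z & v = bracket g x y z]].

Fixpoint derived_series (n : nat) : set g :=
  if n is m.+1
  then bracket_span (derived_series m) (derived_series m) setT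
  else setT.

Fixpoint central_series (n : nat) : set g :=
  if n is m.+1 then bracket_span (central_series m) setT setT else setT.

Definition solvable : Prop := exists k, derived_series k = [set 0].
Definition nilpotent : Prop := exists k, central_series k = [set 0].

End Series.

(* rho : g x g -> End(M), bilinear, is encoded as a trilinear map
   g x g x M -> M. *)
Record is_representation (K : fieldType) (g : bihom3 K) (M : superType K)
    (rho : trilin g g M M) (alphaM betaM : {linear M -> M}) : Prop := {
  alphaM_even : even_map alphaM;
  betaM_even : even_map betaM;
  alphaM_betaM : forall m, alphaM (betaM m) = betaM (alphaM m);
  rho_even : even3 rho;
  rho_skew : forall (i j : 'Z_2) (u v : g), homog i u -> homog j v ->
    forall m, rho u v m = - (sgn (i * j) *: rho v u m);
  rho_alpha : forall u v m,
    rho (alpha g u) (alpha g v) (alphaM m) = alphaM (rho u v m);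
  rho_beta : forall u v m,
    rho (beta g u) (beta g v) (betaM m) = betaM (rho u v m);
  rho_R3 : forall (du dv dx dy : 'Z_2) (u v x y : g),
    homog du u -> homog dv v -> homog dx x -> homog dy y ->
    forall m,
    rho (alpha g (beta g u)) (alpha g (beta g v)) (rho x y m) =
      sgn ((du + dv) * (dx + dy)) *:
        rho (beta g x) (beta g y) (rho (alpha g u) (alpha g v) m)
    + rho (bracket g (beta g u) (beta g v) x) (beta g y) (betaM m)
    + sgn (dx * (du + dv)) *:
        rho (beta g x) (bracket g (beta g u) (beta g v) y) (betaM m);
  rho_R4 : forall (du dv dx dy : 'Z_2) (u v x y : g),
    homog du u -> homog dv v -> homog dx x -> homog dy y ->
    forall m,
    rho (bracket g (beta g u) (beta g v) x) (beta g y) (betaM m) =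
      sgn (du * (dx + dv)) *:
        rho (alpha g (beta g v)) (beta g x) (rho (alpha g u) y m)
    + sgn (dx * (du + dv)) *:
        rho (beta g x) (alpha g (beta g u)) (rho (alpha g v) y m)
    + rho (alpha g (beta g u)) (alpha g (beta g v)) (rho x y m) }.

Record is_3cocycle (K : fieldType) (g : bihom3 K) (M : superType K)
    (rho : trilin g g M M) (alphaM betaM : {linear M -> M})
    (theta : trilin g g g M) : Prop := {
  theta_even : even3 theta;
  theta_alpha : forall x1 x2 x3,
    alphaM (theta x1 x2 x3) = theta (alpha g x1) (alpha g x2) (alpha g x3);
  theta_beta : forall x1 x2 x3,
    betaM (theta x1 x2 x3) = theta (beta g x1) (beta g x2) (beta g x3);
  theta_skew12 : forall (i j k : 'Z_2) (x1 x2 x3 : g),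
    homog i x1 -> homog j x2 -> homog k x3 ->
    theta (beta g x1) (beta g x2) (alpha g x3) =
    - (sgn (i * j) *: theta (beta g x2) (beta g x1) (alpha g x3));
  theta_skew23 : forall (i j k : 'Z_2) (x1 x2 x3 : g),
    homog i x1 -> homog j x2 -> homog k x3 ->
    theta (beta g x1) (beta g x2) (alpha g x3) =
    - (sgn (j * k) *: theta (beta g x1) (beta g x3) (alpha g x2));
  theta_C4 : forall (d1 d2 d3 d4 d5 : 'Z_2) (x1 x2 x3 x4 x5 : g),
    homog d1 x1 -> homog d2 x2 -> homog d3 x3 -> homog d4 x4 -> homog d5 x5 ->
    let b2 t := beta g (beta g t) in
    let Theta a b c d e :=
      theta (b2 a) (b2 b) (bracket g (beta g c) (beta g d) (alpha g e))
      + rho (b2 a) (b2 b) (theta (beta g c) (beta g d) (alpha g e)) in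
    Theta x1 x2 x3 x4 x5 =
      sgn ((d4 + d5) * (d1 + d2 + d3)) *: Theta x4 x5 x1 x2 x3
    - sgn ((d3 + d5) * (d1 + d2) + d4 * d5) *: Theta x3 x5 x1 x2 x4
    + sgn ((d3 + d4) * (d1 + d2)) *: Theta x3 x4 x1 x2 x5 }.

Section Coadjoint.
Variables (K : fieldType) (g : bihom3 K).

Definition ad (x y : g) : {linear g -> g} := tri_ad (bracket g) x y.

Definition coad_homog (i j k : 'Z_2) (x y : g) (f : dual g) : dual g :=
  - (sgn (k * (i + j)) *: transpose (ad x y) f).

Lemma coad_homog_trilinear i j k : trilinear (coad_homog i j k).
Proof.
pose T x y f := transpose (ad x y) f.
suff TP : trilinear T.
  rewrite (_ : coad_homog i j k =
    fun x y f => (- sgn (k * (i + j))) *: T x y f); first exact: trilinearZ.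
  by apply/funext => x; apply/funext => y; apply/funext => f; rewrite scaleNr.
case: (tri_funP (bracket g)) => br1 br2 _.
split=> [y f|x f|x y] a u v; last exact: linearP.
- by apply: dualP => z; rewrite /= -linearP /=; congr (f _); exact: br1.
- by apply: dualP => z; rewrite /= -linearP /=; congr (f _); exact: br2.
Qed.

Definition coad : trilin g g (dual g) (dual g) :=
  Trilin (homog_ext_trilinear coad_homog_trilinear).

Lemma coadE i j k x y (f : dual g) : homog i x -> homog j y -> homog k f ->
  coad x y f = - (sgn (k * (i + j)) *: transpose (ad x y) f).
Proof. exact: homog_extE coad_homog_trilinear. Qed.

End Coadjoint.

Section Inverse.
Variables (K : fieldType) (V : lmodType K).

Definition inv_map (f : V -> V) : V -> V := 'pinv_(fun=> 0) [set: V] f.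

Lemma inv_mapK (f : V -> V) : bijective f -> cancel f (inv_map f).
Proof.
move=> fbij x; apply: pinvKV; rewrite ?in_setE //.
by move=> y z _ _; exact: bij_inj.
Qed.

Lemma inv_mapVK (f : V -> V) : bijective f -> cancel (inv_map f) f.
Proof. by move=> fbij y; case: (fbij) => h _ hK; rewrite -(hK y) inv_mapK. Qed.

Lemma inv_map_linear (f : {linear V -> V}) :
  bijective f -> linear (inv_map f).
Proof.
move=> fbij a x y; apply: (bij_inj fbij).
by rewrite linearP !inv_mapVK.
Qed.

Lemma transpose_bij (f : {linear V -> V}) :
  bijective f -> bijective (transpose f).
Proof.
move=> fbij.
pose fVL := GRing.isLinear.Build K V V _ (inv_map f) (inv_map_linear fbij).
pose fV : {linear V -> V} := HB.pack (inv_map f) fVL.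
exists (transpose fV) => h; apply: dualP => x /=; congr (h _).
- exact: inv_mapVK.
- exact: inv_mapK.
Qed.

End Inverse.

Section TExtension.
Variables (K : fieldType) (g : bihom3 K) (theta : trilin g g g (dual g)).

Definition T_bracket_homog (i j k : 'Z_2) (u v w : (g * dual g)%type) :
    (g * dual g)%type :=
  let: (x, f) := u in let: (y, h) := v in let: (z, l) := w in
  let alpha_inv_beta t := inv_map (alpha g) (beta g t) in
  let talpha_tbeta_inv t :=
    transpose (alpha g) (inv_map (transpose (beta g)) t) in
  (bracket g x y z,
   theta x y z + coad g x y l
   - sgn (j * k) *: coad g x (alpha_inv_beta z) (talpha_tbeta_inv h)
   + sgn (i * (j + k)) *: coad g y (alpha_inv_beta z) (talpha_tbeta_inv f)).

Hypotheses (alpha_bij : bijective (alpha g)) (beta_bij : bijective (beta g)).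

Lemma T_bracket_homog_trilinear i j k : trilinear (T_bracket_homog i j k).
Proof.
pose q t := inv_map (alpha g) (beta g t).
pose r t := transpose (alpha g) (inv_map (transpose (beta g)) t).
have qL : linear q by move=> a x y; rewrite /q linearP inv_map_linear.
have rL : linear r.
  by move=> a x y; rewrite /r inv_map_linear ?linearP //; exact: transpose_bij.
have fstL : linear (@fst g (dual g)) by [].
have sndL : linear (@snd g (dual g)) by [].
have q1L : linear (fun u : (g * dual g)%type => q u.1).
  by move=> a x y; exact: qL.
have r2L : linear (fun u : (g * dual g)%type => r u.2).
  by move=> a x y; exact: rL.
rewrite (_ : T_bracket_homog i j k = fun u v w =>
  (bracket g u.1 v.1 w.1,
   theta u.1 v.1 w.1 + coad g u.1 v.1 w.2
   + (- sgn (j * k)) *: coad g u.1 (q w.1) (r v.2)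
   + sgn (i * (j + k)) *: coad g v.1 (q w.1) (r u.2))); last first.
  apply/funext => -[x f]; apply/funext => -[y h]; apply/funext => -[z l].
  by rewrite /= scaleNr.
have cL := tri_funP (coad g).
apply: trilinear_pair; first exact: (trilinear_comp _ _ _ (tri_funP _)).
apply: trilinearD; first apply: trilinearD; first apply: trilinearD.
- exact: (trilinear_comp _ _ _ (tri_funP _)).
- exact: (trilinear_comp _ _ _ cL).
- apply: trilinearZ.
  exact: (trilinear_swap (trilinear_comp fstL q1L r2L cL)).
- apply: trilinearZ.
  exact: (trilinear_rot (trilinear_comp fstL q1L r2L cL)).
Qed.

Definition T_bracket : trilin (g * dual g)%type (g * dual g)%type
    (g * dual g)%type (g * dual g)%type :=
  Trilin (homog_ext_trilinear T_bracket_homog_trilinear).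

Lemma T_bracketE i j k x y z (f h l : dual g) :
  homog i x -> homog i f -> homog j y -> homog j h -> homog k z -> homog k l ->
  T_bracket (x, f) (y, h) (z, l) =
  T_bracket_homog i j k (x, f) (y, h) (z, l).
Proof.
move=> xi fi yj hj zk lk.
by apply: homog_extE T_bracket_homog_trilinear _ _ _; apply/dsum_homogP.
Qed.

Definition T_extension : bihom3 K :=
  @Bihom3 K (g * dual g)%type T_bracket
    (dsum_map (alpha g) (transpose (alpha g)))
    (dsum_map (beta g) (transpose (beta g))).

End TExtension.

(* Main.v *)
(** The first component of the T_theta-bracket is the bracket of g, so the
    n-th term of either series of the extension lies over the n-th term of the
    series of g, hence inside the dual g^* once the latter vanishes.

    Solvable case: a bracket with two arguments in g^* is zero.

    Nilpotent case: if u = f lies in g^*, then [u, v, w]_theta is up to sign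
    f o beta^-1 o alpha o ad(y, alpha^-1 beta z).  By super-skewsymmetry and
    invariance of the central series under alpha and beta, ad(y, z) maps the
    n-th term g^n to g^(n+1).  So if f vanishes on g^(n+1), then [u, v, w]_theta
    vanishes on g^n: if g^k = 0, each step after the k-th enlarges the space on
    which the functionals vanish, and after k more steps it is all of g. *)

From HB Require Import structures.
Require Import Defs.
From mathcomp Require Import all_boot all_order all_algebra.
From mathcomp Require Import all_classical.

Set Implicit Arguments.
Unset Strict Implicit.
Unset Printing Implicit Defensive.
Import GRing.Theory.
Local Open Scope classical_set_scope.
Local Open Scope ring_scope.

(** * Subspaces, graded subsets and linear spans *)

Definition subspace (K : fieldType) (V : lmodType K) (A : set V) : Prop :=
  A 0 /\ forall a x y, A x -> A y -> A (a *: x + y).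

Definition graded (K : fieldType) (V : superType K) (A : set V) : Prop :=
  forall i x, A x -> A (hcomp i x).

Section Subspaces.
Variables (K : fieldType) (V : lmodType K).
Implicit Types A : set V.

Lemma subspace_setT : subspace [set: V].
Proof. by []. Qed.

Lemma subspace_set0 : subspace [set (0 : V)].
Proof. by split=> // a _ _ -> ->; rewrite /= scaler0 addr0. Qed.

Lemma subspaceD A x y : subspace A -> A x -> A y -> A (x + y).
Proof. by move=> [_ AP] Ax Ay; rewrite -[x]scale1r; exact: AP. Qed.

Lemma subspaceZ A a x : subspace A -> A x -> A (a *: x).
Proof. by move=> [A0 AP] Ax; rewrite -[_ *: _]addr0; exact: AP. Qed.

Lemma subspaceN A x : subspace A -> A x -> A (- x).
Proof. by move=> AP Ax; rewrite -scaleN1r; exact: subspaceZ. Qed.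

Lemma subspace_sum A (I : finType) (F : I -> V) :
  subspace A -> (forall i, A (F i)) -> A (\sum_i F i).
Proof.
move=> AP AF; elim/big_ind: _ => //; first by case: AP.
by move=> *; exact: subspaceD.
Qed.

Lemma subspace_preimage (W : lmodType K) (B : set W) (f : V -> W) :
  linear f -> subspace B -> subspace [set x | B (f x)].
Proof.
move=> fL [B0 BP]; split=> [|a x y Bx By] /=; last by rewrite fL; exact: BP.
have := fL (-1) 0 0.
by rewrite scaleN1r oppr0 addr0 scaleN1r addNr => ->.
Qed.

Lemma lspan_sub A B : subspace B -> A `<=` B -> lspan A `<=` B.
Proof.
move=> BP AB x [n [c [v [Av ->]]]]; apply: subspace_sum => // i.
by apply: subspaceZ => //; apply/AB/Av.
Qed.

Lemma lspan_mem A : A `<=` lspan A.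
Proof.
move=> x Ax; exists 1%N, (fun=> 1), (fun=> x); split=> //.
by rewrite big_ord1 scale1r.
Qed.

Lemma lspan_subspace A : subspace (lspan A).
Proof.
split=> [|a x y [n [c [v [Av ->]]]] [m [d [w [Aw ->]]]]].
  exists 0%N, (fun=> 0), (fun=> 0); split=> [[]//|].
  by rewrite big_ord0.
(* Concatenate the two families, the first rescaled by [a]; [split] tells which half an index lies
   in. *)
exists (n + m)%N,
  (fun i => match fintype.split i with inl j => a * c j | inr j => d j end),
  (fun i => match fintype.split i with inl j => v j | inr j => w j end).
split=> [i|]; first by case: fintype.split.
rewrite big_split_ord scaler_sumr; congr (_ + _); apply: eq_bigr => i _.
  by rewrite -[lshift _ _]/(unsplit (inl i)) unsplitK scalerA.
by rewrite -[rshift _ _]/(unsplit (inr i)) unsplitK.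
Qed.

End Subspaces.

(** * Reduction to homogeneous components *)

Section HomogeneousParts.
Variables (K : fieldType) (U V W : superType K).

Lemma trilinear_hcomp (X : lmodType K) (f : U -> V -> W -> X) x y z :
  trilinear f ->
  f x y z = \sum_i \sum_j \sum_k f (hcomp i x) (hcomp j y) (hcomp k z).
Proof.
move=> fP; have Lsum (E Y : lmodType K) (h : E -> Y) (I : finType)
    (F : I -> E) : linear h -> h (\sum_i F i) = \sum_i h (F i).
  move=> hL; pose hP := GRing.isLinear.Build K E Y _ h hL.
  pose h' : {linear E -> Y} := HB.pack h hP.
  exact: (linear_sum h').
case: fP => f1 f2 f3.
rewrite -{1}(hcomp_sum x) (Lsum _ _ (fun t => f t y z)) //.
apply: eq_bigr => i _.
rewrite -{1}(hcomp_sum y) (Lsum _ _ (fun t => f _ t z)) //.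
by apply: eq_bigr => j _; rewrite -{1}(hcomp_sum z) Lsum.
Qed.

Lemma homog_hcomp i (x : V) : homog i (hcomp i x).
Proof. by rewrite /homog hcomp_hcomp eqxx. Qed.

(** Both [coad] and [T_bracket] are a [homog_ext], so this reduces membership of their values to the
    formulas on homogeneous components. *)
Lemma subspace_homog_ext (X : lmodType K) (B : set X)
    (F : 'Z_2 -> 'Z_2 -> 'Z_2 -> U -> V -> W -> X) x y z :
  subspace B ->
  (forall i j k, B (F i j k (hcomp i x) (hcomp j y) (hcomp k z))) ->
  B (homog_ext F x y z).
Proof. by move=> BP BF; do 3 (apply: subspace_sum => // ?). Qed.

End HomogeneousParts.

(** * The derived and central series of [g] *)

Section Series.
Variables (K : fieldType) (g : bihom3 K).
Implicit Types A B C : set g.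

Lemma bracket_span_sub A B C (D : set g) : subspace D ->
  (forall x y z, A x -> B y -> C z -> D (bracket g x y z)) ->
  bracket_span A B C `<=` D.
Proof.
move=> DP ABC; apply: lspan_sub => // _ [x [y [z [Ax By Cz ->]]]].
exact: ABC.
Qed.

Lemma bracket_span_mem A B C x y z :
  A x -> B y -> C z -> bracket_span A B C (bracket g x y z).
Proof. by move=> Ax By Cz; apply: lspan_mem; exists x, y, z. Qed.

(** Once the arguments are split into homogeneous components, evenness makes each bracket
    homogeneous, so [hcomp i] fixes or kills it. *)
Lemma bracket_span_graded A B C : even3 (bracket g) ->
  graded A -> graded B -> graded C -> graded (bracket_span A B C).
Proof.
move=> brE gA gB gC i.
have SP : subspace (bracket_span A B C) by exact: lspan_subspace.
apply: bracket_span_sub => [|x y z Ax By Cz].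
  by apply: subspace_preimage => //; exact: linearP.
rewrite (trilinear_hcomp x y z (tri_funP _)) /= linear_sum.
apply: subspace_sum => // a; rewrite linear_sum.
apply: subspace_sum => // b; rewrite linear_sum.
apply: subspace_sum => // c.
rewrite (hcomp_homog i (brE _ _ _ _ _ _ (homog_hcomp a x) (homog_hcomp b y)
  (homog_hcomp c z))).
case: eqP => _; last by case: SP.
by apply: bracket_span_mem; [exact: gA|exact: gB|exact: gC].
Qed.

Lemma derived_series_subspace n : subspace (derived_series (g := g) n).
Proof. by case: n => [|n]; [exact: subspace_setT|exact: lspan_subspace]. Qed.

Lemma central_series_subspace n : subspace (central_series (g := g) n).
Proof. by case: n => [|n]; [exact: subspace_setT|exact: lspan_subspace]. Qed.

Lemma derived_series_graded n :
  even3 (bracket g) -> graded (derived_series (g := g) n).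
Proof. by move=> brE; elim: n => //= n IH; exact: bracket_span_graded. Qed.

Lemma central_series_graded n :
  even3 (bracket g) -> graded (central_series (g := g) n).
Proof. by move=> brE; elim: n => //= n IH; exact: bracket_span_graded. Qed.

(** Applied below to [alpha], [beta] and their inverses. *)
Lemma central_series_stable (phi : g -> g) n x : linear phi ->
  (forall x y z, phi (bracket g x y z) = bracket g (phi x) (phi y) (phi z)) ->
  central_series n x -> central_series n (phi x).
Proof.
move=> phiL phiM; elim: n x => //= n IH.
apply: bracket_span_sub => [|x y z Ax _ _].
  by apply: subspace_preimage => //; exact: lspan_subspace.
by rewrite /= phiM; apply: bracket_span_mem => //; exact: IH.
Qed.

Lemma inv_map_bracket (phi : g -> g) : bijective phi ->
  (forall x y z, phi (bracket g x y z) = bracket g (phi x) (phi y) (phi z)) ->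
  forall x y z, inv_map phi (bracket g x y z) =
    bracket g (inv_map phi x) (inv_map phi y) (inv_map phi z).
Proof.
by move=> phiB phiM x y z; apply: (bij_inj phiB); rewrite phiM !inv_mapVK.
Qed.

(** The series grows by bracketing in the first slot, and two transpositions carry the last slot
    there. Skew-symmetry is available only in the form [[beta, beta, alpha]], so bijectivity is used
    to write the arguments that way. *)
Lemma ad_central_series n x y z :
  is_3BihomLie g -> bijective (alpha g) -> bijective (beta g) ->
  central_series n z -> central_series n.+1 (bracket g x y z).
Proof.
move=> gL aB bB zn.
have {zn} : central_series n (inv_map (alpha g) z).
  apply: central_series_stable zn; first exact: inv_map_linear.
  exact: inv_map_bracket aB (alpha_bracket gL).
rewrite -[x](inv_mapVK bB) -[y](inv_mapVK bB).
rewrite -[in bracket g _ _ z](inv_mapVK aB z).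
move: (inv_map _ z) (inv_map _ x) (inv_map _ y) => {}z {}x {}y zn.
have fP : trilinear (fun x y z => bracket g (beta g x) (beta g y) (alpha g z)).
  by apply: (trilinear_comp _ _ _ (tri_funP _)); exact: linearP.
have SP := central_series_subspace n.+1.
rewrite (trilinear_hcomp x y z fP).
apply: subspace_sum => // i; apply: subspace_sum => // j.
apply: subspace_sum => // k.
have [[xi yj] zk] := (homog_hcomp i x, homog_hcomp j y, homog_hcomp k z).
(* [z] moves to the second slot, then to the first; the subspace absorbs the signs. *)
rewrite (bracket_skew23 gL xi yj zk) (bracket_skew12 gL xi zk yj).
apply: (subspaceN SP); apply: (subspaceZ _ SP).
apply: (subspaceN SP); apply: (subspaceZ _ SP).
apply: bracket_span_mem => //.
apply: central_series_stable; [exact: linearP|exact: beta_bracket|].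
by apply: central_series_graded => //; exact: bracket_even.
Qed.

End Series.

(** * Annihilators in the dual space *)

Section Annihilator.
Variables (K : fieldType) (g : bihom3 K).

Definition annihilator (A : set g) : set (dual g) :=
  [set f | forall x, A x -> f x = 0].

Lemma annihilator_subspace A : subspace (annihilator A).
Proof.
split=> [//|a f h fA hA] x Ax.
by rewrite -[LHS]/(a *: f x + h x) fA // hA // scaler0 addr0.
Qed.

Lemma annihilator_graded A : graded A -> graded (annihilator A).
Proof. by move=> gA i f fA x Ax; exact/fA/gA. Qed.

Lemma coad_annihilator A B x y f : graded A ->
  (forall x y z, B z -> A (bracket g x y z)) ->
  annihilator A f -> annihilator B (coad g x y f).
Proof.
move=> gA AB fA; have BP := annihilator_subspace B.
apply: (subspace_homog_ext BP) => i j k.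
apply: (subspaceN BP); apply: (subspaceZ _ BP).
by move=> z Bz; exact: (annihilator_graded gA k fA (AB _ _ _ Bz)).
Qed.

End Annihilator.

(** * The two series of the extension *)

Section TExtensionSeries.
Variables (K : fieldType) (g : bihom3 K) (theta : trilin g g g (dual g)).
Hypotheses (alpha_bij : bijective (alpha g)) (beta_bij : bijective (beta g)).
Hypothesis g_lie : is_3BihomLie g.

Let T := T_extension theta alpha_bij beta_bij.
(* Otherwise /= unfolds coad g into homog_ext, and trilin0l no longer applies. *)
#[local] Arguments tri_fun : simpl never.
Let brE : even3 (bracket g) := bracket_even g_lie.

Lemma fst_subspace (A : set g) :
  subspace A -> subspace [set u : (g * dual g)%type | A u.1].
Proof. exact: subspace_preimage. Qed.

Lemma T_bracket_fst (A B C D : set g) (u v w : T) :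
  subspace D -> graded A -> graded B -> graded C ->
  (forall x y z, A x -> B y -> C z -> D (bracket g x y z)) ->
  A u.1 -> B v.1 -> C w.1 -> D (bracket T u v w).1.
Proof.
move=> DP gA gB gC ABC; case: u v w => [x f] [y h] [z l] /= Ax By Cz.
apply: (subspace_homog_ext (fst_subspace DP)) => i j k.
by apply: ABC; [exact: gA|exact: gB|exact: gC].
Qed.

Lemma derived_series_fst n (u : T) :
  derived_series n u -> derived_series n u.1.
Proof.
elim: n u => //= n IH; have gn := derived_series_graded (n := n) brE.
have SP := derived_series_subspace g n.+1.
apply: (bracket_span_sub (g := T) (fst_subspace SP)) => u v w /IH un /IH vn _.
apply: (T_bracket_fst (C := setT) SP gn gn _ _ un vn) => // x y z xn yn _.
exact: bracket_span_mem.
Qed.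

Lemma central_series_fst n (u : T) :
  central_series n u -> central_series n u.1.
Proof.
elim: n u => //= n IH; have gn := central_series_graded (n := n) brE.
have SP := central_series_subspace g n.+1.
apply: (bracket_span_sub (g := T) (fst_subspace SP)) => u v w /IH un _ _.
apply: (T_bracket_fst (B := setT) (C := setT) SP gn _ _ _ un) => // x y z xn _ _.
exact: bracket_span_mem.
Qed.

Lemma trilin0l (U V W X : lmodType K) (f : trilin U V W X) y z : f 0 y z = 0.
Proof.
case: (tri_funP f) => f1 _ _; have := f1 y z (-1) 0 0.
by rewrite scaleN1r oppr0 addr0 scaleN1r addNr.
Qed.

(** Every term of the bracket has a component of [u.1] or [v.1] as first argument of a trilinear
    map. *)
Lemma T_bracket_dual2 (u v w : T) :
  u.1 = 0 -> v.1 = 0 -> bracket T u v w = 0.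
Proof.
case: u v w => [x f] [y h] [z l] /= -> ->.
have SP := subspace_set0 (g * dual g)%type.
apply: (subspace_homog_ext SP) => i j k /=.
by rewrite !linear0 !trilin0l !scaler0 subr0 !addr0.
Qed.

(** Only the [coad] term containing [f o beta^-1 o alpha] survives. Stability of [A] under [alpha]
    and [beta^-1] makes this twisted functional vanish on [A], and [coad_annihilator] leads from [A]
    to [B]. *)
Lemma T_bracket_annihilator (A B : set g) (u v w : T) :
  graded A -> (forall x y z, B z -> A (bracket g x y z)) ->
  (forall x, A x -> A (alpha g x)) ->
  (forall x, A x -> A (inv_map (beta g) x)) ->
  u.1 = 0 -> annihilator A u.2 ->
  (bracket T u v w).1 = 0 /\ annihilator B (bracket T u v w).2.
Proof.
move=> gA AB Aa Ab; case: u v w => [x f] [y h] [z l] /= -> fA.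
have AP := annihilator_subspace B.
have SP : subspace [set u : (g * dual g)%type | u.1 = 0 /\ annihilator B u.2].
  split=> [|a [x1 f1] [x2 f2] /= [-> f1B] [-> f2B]].
    by split=> //; case: AP.
  split; first by rewrite scaler0 addr0.
  by case: AP => _; apply.
apply: (subspace_homog_ext SP) => i j k; split; rewrite /= linear0 !trilin0l //.
rewrite scaler0 subr0 !add0r.
apply: (subspaceZ _ AP); apply: (coad_annihilator _ _ gA AB) => t At.
set e := inv_map _ _; rewrite -[LHS]/(e (alpha g t)).
(* Writing [alpha t] as [beta (beta^-1 (alpha t))] cancels the inverse of [transpose beta] and
   leaves a component of [f] at [beta^-1 (alpha t)]. *)
rewrite -[alpha g t](inv_mapVK beta_bij).
rewrite -[LHS]/(transpose (beta g) e _) inv_mapVK; last exact: transpose_bij.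
exact: (annihilator_graded gA i fA (Ab _ (Aa _ At))).
Qed.

Lemma series_eq0 (S : set T) : S 0 -> (forall u, S u -> u = 0) -> S = [set 0].
Proof. by move=> S0 SE; apply/seteqP; split=> u /= => [/SE|->]. Qed.

Lemma T_solvable : solvable g -> solvable T.
Proof.
(* Term [k] already lies in the dual; one more bracket has two arguments there. *)
move=> [k gk]; exists k.+1; apply: series_eq0.
  by case: (derived_series_subspace T k.+1).
have SP := subspace_set0 T.
apply: (bracket_span_sub SP) => u v w /derived_series_fst + /derived_series_fst.
by rewrite gk => /= u0 v0 _; exact: T_bracket_dual2.
Qed.

Lemma T_central_series_annihilator k n (u : T) :
  central_series (g := g) k = [set 0] -> (n <= k)%N ->
  central_series (k + n) u ->
  u.1 = 0 /\ annihilator (central_series (k - n)) u.2.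
Proof.
move=> gk; elim: n u => [|n IH] u nk.
  (* For [n = 0] the term of [g] to annihilate is zero, so any functional qualifies. *)
  rewrite addn0 subn0 => /central_series_fst; rewrite gk /= => u0.
  by split=> // x ->; rewrite linear0.
rewrite addnS; move: u; apply: bracket_span_sub.
  have [A0 AP] := annihilator_subspace (central_series (g := g) (k - n.+1)).
  split=> [//|a [x1 f1] [x2 f2] /= [-> f1B] [-> f2B]].
  by split; [rewrite scaler0 addr0|exact: AP].
move=> u v w /(IH _ (ltnW nk)) [u0 uA] _ _.
have gn := central_series_graded (n := k - n) brE.
apply: T_bracket_annihilator gn _ _ _ u0 uA => [x y z zn|x|x].
(* Since [n < k], [k - n] is the successor of [k - n.+1]. *)
- by rewrite -subSS subSn //; exact: ad_central_series.
- by apply: central_series_stable; [exact: linearP|exact: alpha_bracket].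
- apply: central_series_stable; first exact: inv_map_linear.
  exact: inv_map_bracket beta_bij (beta_bracket g_lie).
Qed.

Lemma T_nilpotent : nilpotent g -> nilpotent T.
Proof.
(* With [n = k] the functionals vanish on term [0] of the central series, which is all of [g]. *)
move=> [k gk]; exists (k + k)%N; apply: series_eq0.
  by case: (central_series_subspace T (k + k)).
move=> [x f] /(T_central_series_annihilator gk (leqnn k)) /= [-> fA].
by congr (_, _); apply: dualP => y; apply: fA; rewrite subnn.
Qed.

End TExtensionSeries.

Theorem theorem4p6 (K : fieldType) (g : bihom3 K)
    (theta : trilin g g g (dual g))
    (g_lie : is_3BihomLie g)
    (alpha_bij : bijective (alpha g))
    (beta_bij : bijective (beta g))
    (coad_rep : is_representation (coad g)
       (transpose (alpha g)) (transpose (beta g)))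
    (theta_cocycle : is_3cocycle (coad g)
       (transpose (alpha g)) (transpose (beta g)) theta) :
  (solvable g -> solvable (T_extension theta alpha_bij beta_bij)) /\
  (nilpotent g -> nilpotent (T_extension theta alpha_bij beta_bij)).
Proof. by split; [exact: T_solvable|exact: T_nilpotent]. Qed.
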